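(* Let $\bar x\in\mathbb{R}^n$ be a strict local minimizer of (P). Furthermore, let $Y\subseteq\mathbb{R}^m$ be bounded. Then there is a radius $r>0$ such that, for every $\hat y\in Y$ and $\mu\in(0,\mu_g)$, the function $\mathcal L_\mu(\cdot,\hat y)$ admits a local minimizer $x(\mu,\hat y)$ which lies in $\mathbb{B}_r(\bar x)$. Moreover, $x(\mu,\hat y)\to\bar x$ uniformly on $Y$ as $\mu\downarrow0$.
   Context: Setting. $f:\mathbb{R}^n\to\mathbb{R}$ and $c:\mathbb{R}^n\to\mathbb{R}^m$ are twice continuously differentiable; $g:\mathbb{R}^m\to\mathbb{R}\cup\{\infty\}$ is proper, lower semicontinuous and prox-bounded, i.e. $g+\|\cdot\|^2/(2\mu)$ is bounded below on $\mathbb{R}^m$ for some $\mu>0$; $\mu_g\in(0,\infty]$ denotes the supremum of all such $\mu$. Problem (P) is to minimize $\varphi(x):=f(x)+g(c(x))$ over $x\in\mathbb{R}^n$, and $\inf\varphi\in\mathbb{R}$. No convexity is assumed. A strict local minimizer $\bar x$ of (P) satisfies $\varphi(\bar x)<\infty$ and $\varphi(x)>\varphi(\bar x)$ for all $x\ne\bar x$ in some neighborhood of $\bar x$. $\mathbb{B}_r(\bar x)$ is the closed Euclidean ball of radius $r$ around $\bar x$. Augmented Lagrangian: for $\mu\in(0,\mu_g)$, $x\in\mathbb{R}^n$ and $y\in\mathbb{R}^m$, $\mathcal L_\mu(x,y):=f(x)+g^\mu(c(x)+\mu y)-\frac{\mu}{2}\|y\|^2$, where $g^\mu(w):=\inf_{z\in\mathbb{R}^m}\{g(z)+\frac{1}{2\mu}\|z-w\|^2\}$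 is the Moreau envelope of $g$.
   Formalization: As stated the claim fails for large μ (f(x)=-x, c(x)=x, g the indicator of {0}). Proved instead: for every μ in (0,μ_g), x(μ,ŷ) is a local minimizer relative to the ball B_r(x̄), and an unconstrained local minimizer for all μ below some μ_0>0 uniform in ŷ∈Y. *)

(* Defs.v *)
From HB Require Import structures.
From mathcomp Require Export all_boot all_order all_algebra.
From mathcomp Require Export all_classical all_reals all_analysis.
Export Order.TTheory GRing.Theory Num.Theory.
Export numFieldNormedType.Exports.

Set Implicit Arguments.
Unset Strict Implicit.
Unset Printing Implicit Defensive.

Local Open Scope classical_set_scope.
Local Open Scope ring_scope.

(* The library norm [`|v|] on ['rV[R]_n] is the sup norm; the Euclidean norm
   is needed for the Moreau envelope, the augmented Lagrangian and the ball.
   Topological notions (nbhs, continuity, boundedness, uniform convergence)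
   are the library's, the two norms being equivalent. *)
Definition enorm (R : realType) (n : nat) (v : 'rV[R]_n) : R :=
  Num.sqrt (\sum_(i < n) v ord0 i ^+ 2).

Definition eball (R : realType) (n : nat) (xbar : 'rV[R]_n) (r : R)
  : set 'rV[R]_n := [set x | enorm (x - xbar) <= r].

(* In finite dimension, continuity of [x |-> 'd h x v] for every fixed [v] is
   continuity of [x |-> 'd h x] in operator norm; likewise at second order. *)
Definition C1_fun (R : realType) (U V : normedModType R) (h : U -> V) : Prop :=
  (forall x : U, differentiable h x) /\
  (forall v : U, continuous (fun x : U => 'd h x v)).

Definition C2_fun (R : realType) (U V : normedModType R) (h : U -> V) : Prop :=
  C1_fun h /\ (forall v : U, C1_fun (fun x : U => 'd h x v)).

Section Composite.
Local Open Scope ereal_scope.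
Context {R : realType} {n m : nat}.
Implicit Types (f : 'rV[R]_n -> R) (c : 'rV[R]_n -> 'rV[R]_m).
Implicit Types (g : 'rV[R]_m -> \bar R) (mu : R).

Definition proper_fun g : Prop :=
  (forall z, g z != -oo) /\ (exists z, g z < +oo).

Definition prox_param g mu : Prop :=
  (0 < mu)%R /\
  exists b : R, forall z, b%:E <= g z + (enorm z ^+ 2 / (2 * mu))%:E.

Definition prox_bounded g : Prop := exists mu, prox_param g mu.

Definition prox_threshold g : \bar R :=
  ereal_sup [set mu%:E | mu in [set mu | prox_param g mu]].

Definition moreau_env g mu (w : 'rV[R]_m) : \bar R :=
  ereal_inf (range (fun z => g z + (enorm (z - w) ^+ 2 / (2 * mu))%:E)).

Definition objective f c g (x : 'rV[R]_n) : \bar R := (f x)%:E + g (c x).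

Definition aug_lagrangian f c g mu (x : 'rV[R]_n) (y : 'rV[R]_m) : \bar R :=
  (f x)%:E + moreau_env g mu (c x + mu *: y) - (mu / 2 * enorm y ^+ 2)%:E.

Definition strict_local_minimizer (h : 'rV[R]_n -> \bar R) (xbar : 'rV[R]_n)
  : Prop := h xbar < +oo /\ \forall x \near xbar^', h xbar < h x.

(* Local minimizer of [h] relative to [A]; [A := setT] is the usual notion of
   an (unconstrained) local minimizer. The relative notion cannot be avoided
   when [mu] is not small: for n = m = 1, f x = - x, c x = x and g the
   indicator of {0}, one has xbar = 0, the threshold is +oo, and
   aug_lagrangian f c g mu x 0 = - x + x ^+ 2 / (2 * mu) has [mu] as its only
   unconstrained local minimizer. *)
Definition local_minimizer_on (A : set 'rV[R]_n) (h : 'rV[R]_n -> \bar R)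
  (x : 'rV[R]_n) : Prop :=
  [/\ A x, h x < +oo & \forall x' \near x, A x' -> h x <= h x'].

Definition local_minimizer (h : 'rV[R]_n -> \bar R) (x : 'rV[R]_n) : Prop :=
  local_minimizer_on setT h x.

End Composite.

(* Main.v *)
Require Import Defs.
From mathcomp Require Import lra ring.

Set Implicit Arguments.
Unset Strict Implicit.
Unset Printing Implicit Defensive.

Local Open Scope classical_set_scope.
Local Open Scope ring_scope.

(** Fix a closed ball around [xbar], of radius [r], on which [xbar] is the only
minimizer of the objective [phi]. Since [mu] is below the prox-boundedness
threshold, [aug_lagrangian f c g mu _ y] is real-valued and lower
semicontinuous, hence attains its minimum over the compact ball at some point
[x mu y].

Choosing [z = c xbar] in the infimum that defines the Moreau envelope bounds
the value at [xbar], and therefore the minimum, by [phi xbar]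
([aug_lagrangian_le_objective]). It remains to see that for small [mu], and
uniformly in [y] in the bounded set [Y], every point of the ball with
augmented Lagrangian at most [phi xbar] is close to [xbar]
([aug_lagrangian_sublevel_near]). Near a point [x0 != xbar] of the ball we have
[phi xbar < phi x0], and lower semicontinuity of [g] together with
prox-boundedness transfers this strict inequality to
[aug_lagrangian f c g mu x y] for [x] near [x0] and [mu] near [0]
([moreau_env_ge_near], [aug_lagrangian_gt_near]): shifting by [mu *: y] is
harmless because [Y] is bounded. The ball with a small neighbourhood of [xbar]
removed is compact, so a covering argument makes the range of [mu] independent
of [x0]. This gives uniform convergence; once the minimizers are in the open
ball they are unconstrained local minimizers.

The estimates on the envelope all come from one parametrised form of Young's
inequality for the squared Euclidean norm ([sqr_enormD_param]), and the lower
semicontinuity of the envelope needs no minimizer in its definition: it follows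
from the concavity of the envelope in [mu^-1]. *)

(** * The Euclidean norm and its balls *)

Section EuclideanNorm.
Context {R : realType} {n : nat}.
Implicit Types (u v w : 'rV[R]_n).

Lemma sqr_enorm v : enorm v ^+ 2 = \sum_(i < n) v ord0 i ^+ 2.
Proof. by rewrite sqr_sqrtr// sumr_ge0// => i _; exact: sqr_ge0. Qed.

Lemma enorm_ge0 v : 0 <= enorm v.
Proof. exact: sqrtr_ge0. Qed.

Lemma enorm0 : enorm (0 : 'rV[R]_n) = 0.
Proof.
by rewrite /enorm big1 ?sqrtr0// => i _; rewrite mxE expr0n.
Qed.

Lemma sqr_enormZ (k : R) v : enorm (k *: v) ^+ 2 = k ^+ 2 * enorm v ^+ 2.
Proof.
rewrite !sqr_enorm mulr_sumr; apply: eq_bigr => i _.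
by rewrite mxE exprMn.
Qed.

Lemma sqr_enormD_young (t : R) u v : 0 < t ->
  enorm (u + v) ^+ 2 <= (1 + t) * enorm u ^+ 2 + (1 + t^-1) * enorm v ^+ 2.
Proof.
move=> t0; rewrite !sqr_enorm !mulr_sumr -big_split/=; apply: ler_sum => i _.
rewrite mxE; set a := u _ _; set b := v _ _.
rewrite -subr_ge0.
have -> : (1 + t) * a ^+ 2 + (1 + t^-1) * b ^+ 2 - (a + b) ^+ 2
   = t^-1 * (t * a - b) ^+ 2 by field; rewrite gt_eqF.
by rewrite mulr_ge0 ?sqr_ge0// invr_ge0 ltW.
Qed.

Lemma coord_le_enorm v i : `|v ord0 i| <= enorm v.
Proof.
rewrite -(@ler_pXn2r _ 2)// ?nnegrE ?normr_ge0 ?enorm_ge0//.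
rewrite real_normK ?num_real// sqr_enorm (bigD1 i)//= lerDl.
by rewrite sumr_ge0// => j _; exact: sqr_ge0.
Qed.

Lemma norm_le_enorm v : `|v| <= enorm v.
Proof.
rewrite [`|v|]mx_normrE; apply: bigmax_le => [|[i j] _ /=].
  exact: enorm_ge0.
by rewrite (ord1 i); exact: coord_le_enorm.
Qed.

Lemma sqr_enorm_le_norm v : enorm v ^+ 2 <= n%:R * `|v| ^+ 2.
Proof.
rewrite sqr_enorm (le_trans (y := \sum_(i < n) `|v| ^+ 2))//; last first.
  by rewrite sumr_const card_ord mulr_natl.
apply: ler_sum => i _; rewrite -real_normK ?num_real// lerXn2r ?nnegrE//.
rewrite [`|v|]mx_normrE.
exact: (@le_bigmax _ _ _ _ (fun ij : 'I_1 * 'I_n => `|v ij.1 ij.2|) (ord0, i)).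
Qed.

Lemma enorm_continuous : continuous (@enorm R n).
Proof.
move=> v; apply: continuous_comp; last exact: sqrt_continuous.
apply: (@cvg_big _ _ _ _ _ _ _ (nbhs v) _ _ (fun i => v ord0 i ^+ 2)) => [|i _].
  exact: add_continuous.
apply: (@cvg_comp _ _ _ (fun w : 'rV[R]_n => w ord0 i) (fun t => t ^+ 2)
  (nbhs v) (nbhs (v ord0 i))); first exact: coord_continuous.
exact: exprn_continuous.
Qed.

Lemma enorm_sub_continuous v : continuous (fun w => enorm (w - v)).
Proof.
move=> w; apply: (@continuous_comp _ _ _ (fun w => w - v) (@enorm R n)).
  by apply: (@cvgB R _ _ (nbhs w) _ id (cst v)); [exact: cvg_id|exact: cvg_cst].
exact: enorm_continuous.
Qed.

Lemma near_enorm_lt v (r : R) : 0 < r -> \forall w \near v, enorm (w - v) < r.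
Proof.
move=> r0; have /cvgrPdist_lt /(_ _ r0) := @enorm_sub_continuous v v.
apply: filterS => w.
by rewrite subrr enorm0 sub0r normrN ger0_norm ?enorm_ge0.
Qed.

Lemma compact_eball v (r : R) : compact (eball v r).
Proof.
apply: bounded_closed_compact.
  exists (`|v| + r); split; first exact: num_real.
  move=> M rM w /= wr; apply: ltW; apply: le_lt_trans rM.
  by rewrite -lerBlDl (le_trans (lerB_dist _ _))// (le_trans (norm_le_enorm _)).
apply: (@preimage_closed _ _ (fun w => enorm (w - v)) [set x | x <= r]) => //.
  by move=> w _; exact: enorm_sub_continuous.
Qed.

End EuclideanNorm.

(** * Minima of lower semicontinuous functions *)

(** If no point of [K] were a minimizer, each value on [K] would exceed the
infimum [M], and covering [K] by the open superlevel sets of [h] would bound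
[h] below on [K] by some number greater than [M]. The same covering argument,
with levels tending to [-oo], shows first that [M] is real. *)
Lemma lsc_attains_min (R : realType) (T : topologicalType) (h : T -> \bar R)
    (K : set T) (x0 : T) : lower_semicontinuous h -> compact K -> K x0 ->
  (h x0 < +oo)%E -> (forall x, h x != -oo%E) ->
  exists2 x, K x & forall z, K z -> (h x <= h z)%E.
Proof.
move=> h_lsc /compact_near_coveringP Kcov Kx0 hx0 h_ninfty.
apply: contrapT => nomin.
have lower x : K x -> exists2 z, K z & (h z < h x)%E.
  move=> Kx; apply: contrapT => nlt; apply: nomin; exists x => // z Kz.
  by rewrite leNgt; apply/negP => zx; apply: nlt; exists z.
have bnd : \forall a \near -oo, K `<=` [set x | (a%:E < h x)%E].
  apply: (Kcov _ _ (fun a x => (a%:E < h x)%E)) => x Kx.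
  have [b bx] : exists b : R, (b%:E < h x)%E.
    move: (h_ninfty x); case: (h x) => [s _| _|//]; last first.
      by exists 0; rewrite ltry.
    by exists (s - 1); rewrite lte_fin ltrBlDr ltrDl.
  have [V Vx Vh] := h_lsc _ _ bx.
  exists (V, [set a | a < b]).
    by split => //; apply: nbhs_ninfty_lt; exact: num_real.
  by case=> y a [/= /Vh by_ ab]; apply: lt_trans by_; rewrite lte_fin.
pose M := ereal_inf (h @` K).
have MltK x : K x -> (M < h x)%E.
  move=> Kx; have [z Kz zx] := lower _ Kx.
  by apply: le_lt_trans zx; apply: ereal_inf_lbound; exists z.
have [a Ka] := filter_ex bnd.
have aM : (a%:E <= M)%E by apply/ereal_infP => _ [x Kx <-]; exact/ltW/Ka.
have [s Ms] : exists s : R, M = s%:E.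
  case EM : M => [s||]; first by exists s.
    by move: (MltK _ Kx0); rewrite EM ltNge leey.
  by move: aM; rewrite EM leeNy_eq.
have above : \forall b \near s^'+, K `<=` [set x | (b%:E < h x)%E].
  apply: (Kcov _ _ (fun b x => (b%:E < h x)%E)) => x Kx.
  have [b sb bx] : exists2 b : R, s < b & (b%:E < h x)%E.
    move: (MltK _ Kx); rewrite Ms; case: (h x) => [t|_|//].
      by rewrite lte_fin => st; exists ((s + t) / 2); rewrite ?lte_fin ?midf_lt.
    by exists (s + 1); rewrite ?ltrDl// ltry.
  have [V Vx Vh] := h_lsc _ _ bx.
  exists (V, [set c | c < b]); first by split => //; exact: nbhs_right_lt.
  by case=> y c [/= /Vh by_ cb]; apply: lt_trans by_; rewrite lte_fin.
have [b [sb Kb]] := filter_ex (filterI (nbhs_right_gt s) above).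
suff : (b%:E <= M)%E by rewrite Ms lee_fin leNgt sb.
by apply/ereal_infP => _ [x Kx <-]; exact/ltW/Kb.
Qed.

(** * The Moreau envelope *)

Section MoreauEnvelope.
Context {R : realType} {m : nat}.
Context {g : 'rV[R]_m -> \bar R} (g_proper : proper_fun g).
Implicit Types (w z : 'rV[R]_m) (mu nu a b : R).

(** Young's inequality with the weight [(nu - mu) / mu]. In this form the
parameters of the quadratic kernels add up, so replacing the centre of the
kernel costs an increase of the parameter by [nu - mu] and a term depending
only on the displacement. *)
Lemma sqr_enormD_param mu nu (u v : 'rV[R]_m) : 0 < mu -> mu < nu ->
  enorm (u + v) ^+ 2 / (2 * nu) <=
  enorm u ^+ 2 / (2 * mu) + enorm v ^+ 2 / (2 * (nu - mu)).
Proof.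
move=> mu0 munu; have nu0 := lt_trans mu0 munu.
have d0 : 0 < nu - mu by rewrite subr_gt0.
rewrite ler_pdivrMr ?mulr_gt0//.
apply: (le_trans (sqr_enormD_young u v (divr_gt0 d0 mu0))).
rewrite le_eqVlt; apply/orP; left; apply/eqP; field.
by rewrite !gt_eqF.
Qed.

Lemma moreau_env_le mu w z :
  (moreau_env g mu w <= g z + (enorm (z - w) ^+ 2 / (2 * mu))%:E)%E.
Proof. by apply: ereal_inf_lbound; exists z. Qed.

Lemma moreau_env_geP mu w a :
  (a%:E <= moreau_env g mu w)%E <->
  forall z s, g z = s%:E -> a <= s + enorm (z - w) ^+ 2 / (2 * mu).
Proof.
split=> [ae z s gz|H].
  by rewrite -lee_fin EFinD -gz (le_trans ae)// moreau_env_le.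
apply/ereal_infP => _ [z _ <-].
move: (g_proper.1 z) (H z); case: (g z) => [s _|_ _|//].
  by move=> /(_ _ erefl); rewrite -EFinD lee_fin.
by rewrite addye// leey.
Qed.

Lemma moreau_env_real mu nu w : prox_param g nu -> 0 < mu -> mu < nu ->
  exists e : R, moreau_env g mu w = e%:E.
Proof.
move=> [nu0 [b bg]] mu0 munu.
have lo : ((b - enorm w ^+ 2 / (2 * (nu - mu)))%:E <= moreau_env g mu w)%E.
  apply/moreau_env_geP => z s gz; rewrite lerBlDr.
  move: (bg z); rewrite gz -EFinD lee_fin => /le_trans; apply.
  by rewrite -addrA lerD2l -{1}(subrK w z) sqr_enormD_param.
have [z0 gz0] := g_proper.2.
have hi : (moreau_env g mu w < +oo)%E.
  apply: (le_lt_trans (moreau_env_le mu w z0)).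
  by rewrite lte_add_pinfty// ltry.
move: lo hi; case: (moreau_env g mu w) => [e _ _|//|//]; first by exists e.
Qed.

(** For fixed [w] the envelope is an infimum of functions that are affine in
[mu^-1], hence it is concave in [mu^-1]. *)
Lemma moreau_env_concave_invparam mu nu la w a b : 0 < mu -> 0 < nu ->
  0 < la < 1 ->
  (a%:E <= moreau_env g mu w)%E -> (b%:E <= moreau_env g nu w)%E ->
  (((1 - la) * a + la * b)%:E <=
    moreau_env g (((1 - la) / mu + la / nu)^-1) w)%E.
Proof.
move=> mu0 nu0 /andP[la0 la1] /moreau_env_geP amu /moreau_env_geP bnu.
apply/moreau_env_geP => z s gz.
have la1' : 0 < 1 - la by rewrite subr_gt0.
have -> : s + enorm (z - w) ^+ 2 / (2 * ((1 - la) / mu + la / nu)^-1) =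
  (1 - la) * (s + enorm (z - w) ^+ 2 / (2 * mu)) +
  la * (s + enorm (z - w) ^+ 2 / (2 * nu)).
  field; rewrite !gt_eqF//= addr_gt0// mulr_gt0//.
by apply: lerD; rewrite ler_pM2l//; [exact: amu|exact: bnu].
Qed.

(** Moving the centre from [w0] to [w] can be paid by enlarging [mu] to some
[mu'], up to an error of order [enorm (w - w0) ^+ 2]; enlarging [mu] slightly
costs little by concavity in [mu^-1]. So first [mu'] is fixed close to [mu],
then [w] close to [w0]. *)
Lemma moreau_env_lsc mu nu : prox_param g nu -> 0 < mu -> mu < nu ->
  lower_semicontinuous (moreau_env g mu).
Proof.
move=> nuP mu0 munu w0 a; have [e eE] := moreau_env_real w0 nuP mu0 munu.
rewrite eE lte_fin => ae.
have [mk kn] := midf_lt munu; set k := (mu + nu) / 2 in mk kn.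
have k0 := lt_trans mu0 mk.
have [b bE] := moreau_env_real w0 nuP k0 kn.
(* Half of the gap [e - a] pays for each of the two changes. *)
pose eta := (e - a) / 2; have eta0 : 0 < eta by rewrite divr_gt0// subr_gt0.
pose D := `|e - b| + eta.
have D0 : 0 < D by rewrite ltr_wpDl.
(* Chosen so that mixing in [b] with weight [la] lowers [e] by at most [eta]. *)
pose la := eta / (2 * D).
have la0 : 0 < la by rewrite divr_gt0// mulr_gt0.
have laD : la * D = eta / 2 by rewrite /la; field; rewrite gt_eqF.
have la1 : la < 1.
  rewrite -(ltr_pM2r D0) laD mul1r /D; have := normr_ge0 (e - b); lra.
have eta_la : e - eta <= (1 - la) * e + la * b.
  have : la * (e - b) <= la * D.
    by rewrite ler_pM2l// (le_trans (ler_norm _))// lerDl ltW.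
  rewrite laD; lra.
pose mu' := ((1 - la) / mu + la / k)^-1.
have mu'mu : mu < mu'.
  rewrite -[X in X < _]invrK ltf_pV2 ?posrE ?invr_gt0//; last first.
    by rewrite addr_gt0// divr_gt0// subr_gt0.
  have : la / k < la / mu by rewrite ltr_pM2l// ltf_pV2.
  lra.
have le_mu' : ((e - eta)%:E <= moreau_env g mu' w0)%E.
  apply: (@le_trans _ _ ((1 - la) * e + la * b)%:E); first by rewrite lee_fin.
  apply: moreau_env_concave_invparam; rewrite ?la0 ?eE ?bE//.
pose r := Num.sqrt (eta * (2 * (mu' - mu))).
have r2 : r ^+ 2 = eta * (2 * (mu' - mu)).
  by rewrite sqr_sqrtr// ltW// !mulr_gt0// subr_gt0.
have r0 : 0 < r by rewrite sqrtr_gt0 !mulr_gt0// subr_gt0.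
exists [set w | enorm (w - w0) < r]; first exact: near_enorm_lt.
move=> w /= wr; have wr2 : enorm (w - w0) ^+ 2 / (2 * (mu' - mu)) < eta.
  rewrite ltr_pdivrMr ?mulr_gt0 ?subr_gt0// -r2.
  by rewrite ltr_pXn2r// ?nnegrE ?enorm_ge0 ?ltW.
pose q := enorm (w - w0) ^+ 2 / (2 * (mu' - mu)).
apply: (@lt_le_trans _ _ (e - eta - q)%:E).
  by rewrite lte_fin; move: wr2; rewrite -/q /eta; lra.
apply/moreau_env_geP => z s gz; rewrite lerBlDr.
move/moreau_env_geP: le_mu' => /(_ _ _ gz) /le_trans; apply.
rewrite -addrA lerD2l (_ : z - w0 = (z - w) + (w - w0)) ?sqr_enormD_param//.
by rewrite addrA subrK.
Qed.

(** Points [z] near [z0] have [g z > a]; for [z] at distance at least [rho] from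
[z0], prox-boundedness bounds [g z] below by a constant minus a fixed multiple of
[enorm (z - z0) ^+ 2], and the kernel with its factor [(2 * mu)^-1] makes up for
this loss as soon as [mu] is small. *)
Lemma moreau_env_ge_near nu (z0 : 'rV[R]_m) a : prox_param g nu ->
  lower_semicontinuous g -> (a%:E < g z0)%E ->
  \forall w \near z0 & mu \near 0^'+, (a%:E <= moreau_env g mu w)%E.
Proof.
move=> nuP g_lsc /g_lsc[V Vz0 Va].
have [rho rho0 rhoV] : exists2 rho : R, 0 < rho &
    forall z, enorm (z - z0) < rho -> V z.
  have /nbhs_normP[rho /= rho0 ballV] := Vz0; exists rho => // z zrho.
  by apply: ballV; rewrite /ball_ /= distrC (le_lt_trans (norm_le_enorm _)).
have nu0 := nuP.1.
(* A parameter below [nu] keeps the lower bound on [g] valid after recentring the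
   quadratic term at [z0]. *)
pose k := nu / 2.
have k0 : 0 < k by rewrite divr_gt0.
have [B BE] : exists B : R, moreau_env g k z0 = B%:E.
  by apply: moreau_env_real nuP _ _ => //; rewrite ltr_pdivrMr// mulr2n; lra.
have /moreau_env_geP gB : (B%:E <= moreau_env g k z0)%E by rewrite BE.
(* The curvature needed to compensate both the quadratic decrease of [g] and,
   at distance [rho], the gap [a - B]. *)
pose S := (2 * k)^-1 + `|a - B| / rho ^+ 2.
have S0 : 0 < S by rewrite ltr_wpDr ?invr_gt0 ?mulr_gt0// divr_ge0// sqr_ge0.
exists ([set w | enorm (w - z0) < rho / 2], [set mu | 0 < mu < (8 * S)^-1]).
  split => /=; first by apply: near_enorm_lt; rewrite divr_gt0.
  near=> mu; apply/andP; split; first by near: mu; exact: nbhs_right_gt.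
  by near: mu; apply: nbhs_right_lt; rewrite invr_gt0 mulr_gt0.
case=> w mu [/= wrho /andP[mu0 muS]]; apply/moreau_env_geP => z s gz.
have [zrho|rhoz] := ltP (enorm (z - z0)) rho.
  rewrite (@le_trans _ _ s)//.
    by apply: ltW; rewrite -lte_fin -gz; apply: Va; exact: rhoV.
  by rewrite lerDl divr_ge0 ?sqr_ge0// ltW// mulr_gt0.
have split_z : enorm (z - z0) ^+ 2 <=
    2 * enorm (z - w) ^+ 2 + 2 * enorm (w - z0) ^+ 2.
  have := sqr_enormD_young (z - w) (w - z0) ltr01.
  by rewrite addrA subrK invr1 -(natrD R 1 1).
have w_small : 4 * enorm (w - z0) ^+ 2 <= rho ^+ 2.
  have -> : rho ^+ 2 = 4 * (rho / 2) ^+ 2 by field.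
  rewrite ler_pM2l// lerXn2r ?nnegrE ?enorm_ge0//; last exact: ltW.
  by rewrite divr_ge0// ltW.
have z_big : rho ^+ 2 <= enorm (z - z0) ^+ 2.
  by rewrite lerXn2r ?nnegrE ?enorm_ge0 ?(ltW rho0).
have zw_far : enorm (z - z0) ^+ 2 <= 4 * enorm (z - w) ^+ 2 by lra.
have S_le : S <= (8 * mu)^-1.
  have : 8 * S <= mu^-1.
    by rewrite -[leLHS]invrK lef_pV2 ?posrE ?invr_gt0 ?mulr_gt0// ltW.
  by rewrite invfM; lra.
have quad : enorm (z - z0) ^+ 2 * S <= enorm (z - w) ^+ 2 / (2 * mu).
  apply: (@le_trans _ _ (4 * enorm (z - w) ^+ 2 * (8 * mu)^-1)).
    by apply: ler_pM => //; rewrite ?sqr_ge0// ltW.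
  by rewrite le_eqVlt; apply/orP; left; apply/eqP; field; rewrite gt_eqF.
have aB : a - B <= enorm (z - z0) ^+ 2 * (`|a - B| / rho ^+ 2).
  rewrite (le_trans (ler_norm _))// mulrCA ler_peMr// ler_pdivlMr ?exprn_gt0//.
  by rewrite mul1r.
have := gB _ _ gz; move: quad; rewrite /S mulrDr; lra.
Unshelve. all: by end_near. Qed.

End MoreauEnvelope.

(** * The augmented Lagrangian *)

Section AugmentedLagrangian.
Context {R : realType} {n m : nat}.
Context {f : 'rV[R]_n -> R} {c : 'rV[R]_n -> 'rV[R]_m}.
Context {g : 'rV[R]_m -> \bar R}.
Context (f_cont : continuous f) (c_cont : continuous c).
Context (g_proper : proper_fun g).
Implicit Types (x : 'rV[R]_n) (y : 'rV[R]_m) (mu nu p : R).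

(** The candidate [z = c x] in the envelope costs exactly the quadratic term in
[y] that the augmented Lagrangian subtracts. *)
Lemma aug_lagrangian_le_objective mu x y : 0 < mu ->
  (aug_lagrangian f c g mu x y <= objective f c g x)%E.
Proof.
move=> mu0; rewrite /aug_lagrangian /objective leeBlDr// -addeA leeD2l//.
apply: (le_trans (moreau_env_le mu _ (c x))); rewrite leeD2l// lee_fin.
rewrite opprD addNKr -scaleNr sqr_enormZ le_eqVlt; apply/orP; left; apply/eqP.
by field; rewrite gt_eqF.
Qed.

Lemma aug_lagrangian_lsc mu nu y : prox_param g nu -> 0 < mu -> mu < nu ->
  lower_semicontinuous (fun x => aug_lagrangian f c g mu x y).
Proof.
move=> nuP mu0 munu x0 a.
have real_env := fun w => moreau_env_real g_proper w nuP mu0 munu.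
have [e eE] := real_env (c x0 + mu *: y).
rewrite /aug_lagrangian eE -EFinD lte_fin => agt.
set q := mu / 2 * _ in agt *; pose d := (f x0 + e - q - a) / 2.
have d0 : 0 < d by rewrite divr_gt0// subr_gt0.
have [V Vw Ve] : exists2 V, nbhs (c x0 + mu *: y) V &
    forall w, V w -> ((e - d)%:E < moreau_env g mu w)%E.
  by apply: (moreau_env_lsc g_proper nuP) => //; rewrite eE lte_fin gtrBl.
have cV : \forall x \near x0, V (c x + mu *: y).
  by apply: (@cvgD R _ _ (nbhs x0) _ c (cst (mu *: y)) (c x0));
    [exact: c_cont|exact: cvg_cst|].
exists [set x | V (c x + mu *: y) /\ f x0 - d < f x].
  apply: filterI => //; apply: (@cvgr_gt _ _ (nbhs x0) _ f (f x0) (@f_cont x0)).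
  by rewrite gtrBl.
move=> x /= [/Ve + fx]; have [e' ->] := real_env (c x + mu *: y).
by rewrite -EFinD !lte_fin; rewrite /d in fx *; lra.
Qed.

(** The neighbourhoods must not depend on [y]: boundedness of [Y] makes both the
shift [mu *: y] of the centre and the term [mu / 2 * enorm y ^+ 2] small with
[mu], uniformly on [Y]. *)
Lemma aug_lagrangian_gt_near nu (Y : set 'rV[R]_m) x0 p : prox_param g nu ->
  lower_semicontinuous g -> bounded_set Y -> (p%:E < objective f c g x0)%E ->
  \forall x \near x0 & mu \near 0^'+,
    forall y, Y y -> (p%:E < aug_lagrangian f c g mu x y)%E.
Proof.
move=> nuP g_lsc /pinfty_ex_gt0[M M0 YM] pphi.
have [a pa ag] : exists2 a, p < f x0 + a & (a%:E < g (c x0))%E.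
  move: pphi (g_proper.1 (c x0)); rewrite /objective.
  case: (g (c x0)) => [s + _|_ _|//].
    rewrite -EFinD lte_fin => ps; exists ((p - f x0 + s) / 2); first by lra.
    by rewrite lte_fin; lra.
  by exists (p - f x0 + 1); [lra|rewrite ltry].
have [[U T] /= [Uc T0] UTe] := moreau_env_ge_near g_proper nuP g_lsc ag.
have /nbhs_normP[rho /= rho0 ballU] := Uc.
pose d := (f x0 + a - p) / 2; have d0 : 0 < d by rewrite divr_gt0// subr_gt0.
(* A bound for the squared Euclidean norm on [Y]; [M] bounds the sup norm. *)
pose C := m%:R * M ^+ 2.
have C0 : 0 <= C by rewrite mulr_ge0 ?sqr_ge0.
have C1 : 0 < C + 1 by rewrite ltr_wpDl.
exists ([set x | `|c x0 - c x| < rho / 2 /\ f x0 - d < f x],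
  [set mu | [/\ 0 < mu, T mu, mu < rho / 2 / M & mu < 2 * d / (C + 1)]]).
  split => /=.
    apply: filterI; last first.
      apply: (@cvgr_gt _ _ (nbhs x0) _ f (f x0) (@f_cont x0)).
      by rewrite gtrBl.
    have /cvgrPdist_lt c_near := @c_cont x0.
    by apply: c_near; rewrite divr_gt0.
  near=> mu; split; near: mu => //.
  - exact: nbhs_right_gt.
  - by apply: nbhs_right_lt; rewrite !divr_gt0.
  - by apply: nbhs_right_lt; rewrite divr_gt0// mulr_gt0.
case=> x mu [/= [cx fx] [mu0 Tmu muM muC]] y Yy.
have yM : `|y| <= M by exact: YM.
have yC : enorm y ^+ 2 <= C.
  rewrite (le_trans (sqr_enorm_le_norm _))// ler_wpM2l//.
  by rewrite lerXn2r ?nnegrE// ltW.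
have Uw : U (c x + mu *: y).
  apply: ballU; rewrite /ball_ /= opprD addrA (le_lt_trans (ler_normB _ _))//.
  rewrite [ltRHS]splitr ltrD// normrZ gtr0_norm//.
  by rewrite (@le_lt_trans _ _ (mu * M)) ?ler_pM2l// -ltr_pdivlMr.
have ae := UTe (_, _) (conj Uw Tmu).
have quad : mu / 2 * enorm y ^+ 2 < d.
  apply: (@le_lt_trans _ _ (mu / 2 * (C + 1))).
    by rewrite ler_pM2l ?divr_gt0// (le_trans yC)// lerDl.
  by move: muC; rewrite ltr_pdivlMr ?ltr_wpDl//; lra.
rewrite /aug_lagrangian.
apply: (@lt_le_trans _ _ (f x + a - mu / 2 * enorm y ^+ 2)%:E).
  by rewrite lte_fin; move: quad fx; rewrite /d; lra.
by rewrite EFinB EFinD leeD2r// leeD2l.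
Unshelve. all: by end_near. Qed.

(** Compactness of the annulus [eps <= enorm (x - xbar) <= r] makes the local
bounds of [aug_lagrangian_gt_near] hold for a common range of [mu]. *)
Lemma aug_lagrangian_sublevel_near nu (Y : set 'rV[R]_m) xbar (r eps p : R) :
  prox_param g nu -> lower_semicontinuous g -> bounded_set Y -> 0 < eps ->
  (forall x, eball xbar r x -> x != xbar -> (p%:E < objective f c g x)%E) ->
  \forall mu \near 0^'+, forall x y, eball xbar r x -> Y y ->
    (aug_lagrangian f c g mu x y <= p%:E)%E -> enorm (x - xbar) < eps.
Proof.
move=> nuP g_lsc Ybd eps0 pphi.
pose K := eball xbar r `&` [set x | eps <= enorm (x - xbar)].
have Kcov : near_covering K.
  apply/compact_near_coveringP.
  apply: subclosed_compact (@compact_eball _ _ xbar r) (@subIsetl _ _ _).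
  apply: closedI.
    by apply: compact_closed; [exact: norm_hausdorff|exact: compact_eball].
  have := @preimage_closed 'rV[R]_n R (fun w => enorm (w - xbar))
    [set t : R | eps <= t].
  apply; last exact: closed_ge.
  by move=> w _; exact: enorm_sub_continuous.
have : \forall mu \near 0^'+, K `<=`
    [set x | forall y, Y y -> (p%:E < aug_lagrangian f c g mu x y)%E].
  apply: (Kcov _ _ (fun mu x => forall y, Y y -> _)) => x [xr xeps].
  apply: (aug_lagrangian_gt_near nuP) => //; apply: pphi => //.
  by apply: contraTneq xeps => ->; rewrite subrr /= enorm0 -ltNge.
apply: filterS => mu Kp x y xr Yy; apply: contraTT.
by rewrite -leNgt -ltNge => epsx; apply: Kp.
Qed.

End AugmentedLagrangian.

(** * Local minimizers of the augmented Lagrangian *)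

Theorem theorem4p7 (R : realType) (n m : nat)
  (f : 'rV[R]_n -> R) (c : 'rV[R]_n -> 'rV[R]_m) (g : 'rV[R]_m -> \bar R)
  (f_C2 : C2_fun (f : 'rV[R]_n -> R^o)) (c_C2 : C2_fun c)
  (g_proper : proper_fun g) (g_lsc : lower_semicontinuous g)
  (g_prox : prox_bounded g)
  (inf_fin : ereal_inf (range (objective f c g)) \is a fin_num)
  (xbar : 'rV[R]_n)
  (xbar_min : strict_local_minimizer (objective f c g) xbar)
  (Y : set 'rV[R]_m) (Y_bounded : bounded_set Y) :
  exists2 r : R, 0 < r &
  exists x : R -> 'rV[R]_m -> 'rV[R]_n,
  [/\ forall (yhat : 'rV[R]_m) (mu : R),
        Y yhat -> 0 < mu -> (mu%:E < prox_threshold g)%E ->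
        local_minimizer_on (eball xbar r)
          (fun z => aug_lagrangian f c g mu z yhat) (x mu yhat),
      exists2 mu0 : R, 0 < mu0 &
        forall (yhat : 'rV[R]_m) (mu : R),
          Y yhat -> 0 < mu < mu0 -> (mu%:E < prox_threshold g)%E ->
          local_minimizer
            (fun z => aug_lagrangian f c g mu z yhat) (x mu yhat)
    & {uniform Y, x mu @[mu --> 0^'+] --> (fun=> xbar)}].
Proof.
have f_cont : continuous f.
  by move=> x; exact: (differentiable_continuous (f_C2.1.1 x)).
have c_cont : continuous c.
  by move=> x; exact: (differentiable_continuous (c_C2.1.1 x)).
have [nu0 nu0P] := g_prox.
have [p pE] : exists p : R, objective f c g xbar = p%:E.
  move: xbar_min.1 (g_proper.1 (c xbar)); rewrite /objective.
  by case: (g (c xbar)) => [s _ _|//|//]; exists (f xbar + s).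
have [rho rho0 rho_min] : exists2 rho : R, 0 < rho & forall x,
    enorm (x - xbar) < rho -> x != xbar -> (p%:E < objective f c g x)%E.
  have /nbhs_normP[rho /= rho0 ball_min] := xbar_min.2.
  exists rho => // x xrho x_xbar; rewrite -pE; apply: ball_min => //.
  by rewrite /ball_ /= distrC (le_lt_trans (norm_le_enorm _)).
(* Halving [rho] makes the closed ball fit into the open one. *)
pose r := rho / 2; have r0 : 0 < r by rewrite divr_gt0.
have r_min x : eball xbar r x -> x != xbar -> (p%:E < objective f c g x)%E.
  move=> xr; apply: rho_min; apply: (le_lt_trans xr).
  by rewrite /r; lra.
pose L mu y := (fun z => aug_lagrangian f c g mu z y).
pose argmin mu y :=
  [set x | eball xbar r x /\
    forall z, eball xbar r z -> (L mu y x <= L mu y z)%E].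
have xbar_in : eball xbar r xbar by rewrite /eball /= subrr enorm0 ltW.
have L_xbar mu y : 0 < mu -> (L mu y xbar <= p%:E)%E.
  by rewrite -pE; exact: aug_lagrangian_le_objective.
pose x mu y := xget xbar (argmin mu y).
have xP mu y : 0 < mu -> (mu%:E < prox_threshold g)%E -> argmin mu y (x mu y).
  move=> mu0 /ereal_sup_gt[_ [nu nuP <-]]; rewrite lte_fin => munu.
  apply: xgetPex.
  have [z Kz zmin] : exists2 z, eball xbar r z &
      forall z', eball xbar r z' -> (L mu y z <= L mu y z')%E.
    apply: (lsc_attains_min (x0 := xbar)) => //.
    - exact: aug_lagrangian_lsc nuP mu0 munu.
    - exact: compact_eball.
    - by rewrite (le_lt_trans (L_xbar _ _ mu0))// ltry.
    - move=> z; rewrite /L /aug_lagrangian.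
      by have [e ->] := moreau_env_real g_proper (c z + mu *: y) nuP mu0 munu.
  by exists z.
have x_le mu y : 0 < mu -> (mu%:E < prox_threshold g)%E ->
    (L mu y (x mu y) <= p%:E)%E.
  by move=> mu0 mug; apply: le_trans (L_xbar mu y mu0); apply: (xP _ _ _ _).2.
have x_near (eps : R) : 0 < eps -> \forall mu \near 0^'+, forall y, Y y ->
    (mu%:E < prox_threshold g)%E -> enorm (x mu y - xbar) < eps.
  move=> eps0; near=> mu => y Yy mug.
  have mu0 : 0 < mu by near: mu; exact: nbhs_right_gt.
  have := x_le _ y mu0 mug; have := (xP _ y mu0 mug).1.
  move: (x mu y) => z zr; move: z y zr Yy {mug}; near: mu.
  exact: (aug_lagrangian_sublevel_near f_cont c_cont g_proper nu0P).
exists r => //; exists x; split.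
- move=> y mu Yy mu0 mug; have [xr xmin] := xP mu y mu0 mug; split => //.
    by rewrite (le_lt_trans (x_le _ _ mu0 mug))// ltry.
  by apply: (@nearW _ (nbhs (x mu y))) => z zr; exact: xmin.
- have [mu0 /= mu0_gt0 near_r] := x_near r r0.
  exists mu0 => // y mu Yy /andP[mu_gt0 mu_lt] mug.
  have [xr xmin] := xP mu y mu_gt0 mug; split => //.
    by rewrite (le_lt_trans (x_le _ _ mu_gt0 mug))// ltry.
  have xlt : enorm (x mu y - xbar) < r.
    by apply: near_r => //=; rewrite sub0r normrN gtr0_norm.
  have : \forall z \near x mu y, enorm (z - xbar) < r.
    exact: (@cvgr_lt _ _ (nbhs (x mu y)) _ _ _
      (@enorm_sub_continuous _ _ xbar _)).
  by apply: (@filterS _ (nbhs (x mu y))) => z zr _; apply: xmin; exact: ltW.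
- move=> P /uniform_nbhs[E [/= entE EP]].
  rewrite -entourage_ballE in entE; have [eps /= eps0 ballE] := entE.
  have := x_near eps eps0.
  have mug_near : \forall mu \near 0^'+, (mu%:E < prox_threshold g)%E.
    exists nu0 => /=; first exact: nu0P.1.
    move=> mu /=; rewrite sub0r normrN => munu mu0; rewrite gtr0_norm// in munu.
    by apply/ereal_sup_gtP; exists nu0%:E; [exists nu0|rewrite lte_fin].
  rewrite nbhs_simpl; apply: filterS2 mug_near => mu mug xeps.
  apply: EP => /= y Yy; apply: ballE => /=.
  rewrite -ball_normE /ball_ /= distrC.
  by rewrite (le_lt_trans (norm_le_enorm _))// xeps.
Unshelve. all: by end_near. Qed.
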